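(* Let $V$ be a special Gelfand--Dorfman algebra over a field $\Bbbk$. Then every homomorphic image of $V$ (as a Gelfand--Dorfman algebra) is a special Gelfand--Dorfman algebra.
   Context: All algebras are over a field $\Bbbk$. A Gelfand--Dorfman algebra (GD-algebra) is a linear space $V$ with two bilinear operations $\circ$ and $[\cdot,\cdot]$ such that: (i) $(V,\circ)$ is a Novikov algebra, i.e. $(a\circ b)\circ c-a\circ(b\circ c)=(b\circ a)\circ c-b\circ(a\circ c)$ and $(a\circ b)\circ c=(a\circ c)\circ b$ for all $a,b,c\in V$; (ii) $(V,[\cdot,\cdot])$ is a Lie algebra; (iii) $b\circ[a,c]=[a,b\circ c]-[c,b\circ a]+[b,a]\circ c-[b,c]\circ a$ for all $a,b,c\in V$. Homomorphisms of GD-algebras are linear maps preserving both operations. A differential Poisson algebra is a Poisson algebra $(P,\cdot,\{\cdot,\cdot\})$ ($(P,\cdot)$ is associative and commutative, $(P,\{\cdot,\cdot\})$ is a Lie algebra, and $\{x,yz\}=y\{x,z\}+z\{x,y\}$) with a linear map $d:P\to P$ that is a derivation with respect to both operations: $d(xy)=x\,d(y)+d(x)\,y$ and $d\{x,y\}=\{d(x),y\}+\{x,d(y)\}$. Given such $P$, the space $P$ with operations $x\circ y=x\,d(y)$, $[x,y]=\{x,y\}$ is a GD-algebra, denoted $P^{(d)}$. A GD-algebra $V$ is special if there exist a differential Poisson algebra $P$ with derivation $d$ and an injective homomorphism of GD-algebras $V\to P^{(d)}$. *)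

(* Defs.v *)
From HB Require Import structures.
From mathcomp Require Import all_boot all_algebra.

Set Implicit Arguments.
Unset Strict Implicit.
Unset Printing Implicit Defensive.

Import GRing.Theory.
Local Open Scope ring_scope.

Declare Scope gd_scope.
Delimit Scope gd_scope with GD.
Local Open Scope gd_scope.

Reserved Notation "x ∘ y" (at level 40, left associativity).
Reserved Notation "x ⋅ y" (at level 40, left associativity).
Reserved Notation "⁅ x , y ⁆" (at level 0, x at level 99, y at level 99).

HB.mixin Record Lmodule_isNovikov (k : fieldType) V of GRing.Lmodule k V := {
  circ : V -> V -> V;
  circ_bilinear : bilinear_for *:%R *:%R circ;
  circ_lsym : forall a b c : V,
    circ (circ a b) c - circ a (circ b c) = circ (circ b a) c - circ b (circ a c);
  circ_rcomm : forall a b c : V, circ (circ a b) c = circ (circ a c) b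
}.

#[short(type="novikovAlgType")]
HB.structure Definition NovikovAlgebra (k : fieldType) :=
  {V of GRing.Lmodule k V & Lmodule_isNovikov k V}.

HB.instance Definition _ (k : fieldType) (V : novikovAlgType k) :=
  bilinear_isBilinear.Build k V V V *:%R *:%R (@circ k V) (@circ_bilinear k V).

Notation "x ∘ y" := (circ x y) : gd_scope.

(* Antisymmetry is required in the alternating form, as it must be in
   characteristic 2. *)
HB.mixin Record Lmodule_isLie (k : fieldType) V of GRing.Lmodule k V := {
  bracket : V -> V -> V;
  bracket_bilinear : bilinear_for *:%R *:%R bracket;
  bracketxx : forall a : V, bracket a a = 0;
  bracket_jacobi : forall a b c : V,
    bracket a (bracket b c) + bracket b (bracket c a) + bracket c (bracket a b) = 0
}.

#[short(type="lieAlgType")]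
HB.structure Definition LieAlgebra (k : fieldType) :=
  {V of GRing.Lmodule k V & Lmodule_isLie k V}.

HB.instance Definition _ (k : fieldType) (V : lieAlgType k) :=
  bilinear_isBilinear.Build k V V V *:%R *:%R (@bracket k V) (@bracket_bilinear k V).

Notation "⁅ x , y ⁆" := (bracket x y) : gd_scope.

HB.mixin Record NovikovLie_isGD (k : fieldType) V
    of NovikovAlgebra k V & LieAlgebra k V := {
  gd_compat : forall a b c : V,
    b ∘ ⁅a, c⁆ = ⁅a, b ∘ c⁆ - ⁅c, b ∘ a⁆ + ⁅b, a⁆ ∘ c - ⁅b, c⁆ ∘ a
}.

#[short(type="gdAlgType")]
HB.structure Definition GDAlgebra (k : fieldType) :=
  {V of NovikovAlgebra k V & LieAlgebra k V & NovikovLie_isGD k V}.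

Definition gd_morphism (k : fieldType) (V W : gdAlgType k) (f : {linear V -> W}) :=
  {morph f : x y / x ∘ y} /\ {morph f : x y / ⁅x, y⁆}.

(* The product is not required to have a unit, whence a bilinear operation
   instead of MathComp's (unital) commutative algebras. *)
HB.mixin Record Lie_isPoisson (k : fieldType) P of LieAlgebra k P := {
  pmul : P -> P -> P;
  pmul_bilinear : bilinear_for *:%R *:%R pmul;
  pmulA : associative pmul;
  pmulC : commutative pmul;
  poisson_leibniz : forall x y z : P,
    ⁅x, pmul y z⁆ = pmul y ⁅x, z⁆ + pmul z ⁅x, y⁆
}.

#[short(type="poissonAlgType")]
HB.structure Definition PoissonAlgebra (k : fieldType) :=
  {P of LieAlgebra k P & Lie_isPoisson k P}.

HB.instance Definition _ (k : fieldType) (P : poissonAlgType k) :=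
  bilinear_isBilinear.Build k P P P *:%R *:%R (@pmul k P) (@pmul_bilinear k P).

Notation "x ⋅ y" := (pmul x y) : gd_scope.

HB.mixin Record Poisson_isDifferential (k : fieldType) P of PoissonAlgebra k P := {
  pder : P -> P;
  pder_linear : linear pder;
  pder_mul : forall x y : P, pder (x ⋅ y) = x ⋅ pder y + pder x ⋅ y;
  pder_bracket : forall x y : P, pder ⁅x, y⁆ = ⁅pder x, y⁆ + ⁅x, pder y⁆
}.

#[short(type="diffPoissonAlgType")]
HB.structure Definition DiffPoissonAlgebra (k : fieldType) :=
  {P of PoissonAlgebra k P & Poisson_isDifferential k P}.

HB.instance Definition _ (k : fieldType) (P : diffPoissonAlgType k) :=
  GRing.isLinear.Build k P P *:%R (@pder k P) (@pder_linear k P).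

(* gd_of P is P^(d): a copy of P carrying the structure of GD-algebra
   x ∘ y = x ⋅ pder y, with the Poisson bracket as Lie bracket. *)
Definition gd_of (k : fieldType) (P : diffPoissonAlgType k) : Type := P.

Section GDOf.
Variables (k : fieldType) (P : diffPoissonAlgType k).
Implicit Types a b c x y z : P.

HB.instance Definition _ := LieAlgebra.on (gd_of P).

Let bracketC x y : ⁅x, y⁆ = - ⁅y, x⁆.
Proof.
have := bracketxx (x + y); rewrite linearDl /= !linearDr /= !bracketxx add0r addr0.
by move/eqP; rewrite addr_eq0 => /eqP.
Qed.

Definition dcirc x y : P := x ⋅ pder y.

Fact dcirc_bilinear : bilinear_for *:%R *:%R (dcirc : gd_of P -> gd_of P -> gd_of P).
Proof.
split=> [z t x y | x t y z]; rewrite /dcirc; first exact: linearPl.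
by rewrite linearP; exact: linearPr.
Qed.

Fact dcirc_lsym a b c :
  dcirc (dcirc a b) c - dcirc a (dcirc b c) = dcirc (dcirc b a) c - dcirc b (dcirc a c).
Proof.
have E x y : dcirc (dcirc x y) c - dcirc x (dcirc y c) = - (x ⋅ y ⋅ pder (pder c)).
  by rewrite /dcirc pder_mul linearDr /= !pmulA opprD addrCA subrr addr0.
by rewrite !E [a ⋅ b]pmulC.
Qed.

Fact dcirc_rcomm a b c : dcirc (dcirc a b) c = dcirc (dcirc a c) b.
Proof. by rewrite /dcirc -!pmulA [pder b ⋅ _]pmulC. Qed.

HB.instance Definition _ := Lmodule_isNovikov.Build k (gd_of P)
  dcirc_bilinear dcirc_lsym dcirc_rcomm.

Fact dcirc_compat a b c :
  dcirc b ⁅a, c⁆ =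
  ⁅a, dcirc b c⁆ - ⁅c, dcirc b a⁆ + dcirc ⁅b, a⁆ c - dcirc ⁅b, c⁆ a.
Proof.
rewrite /dcirc pder_bracket linearDr /= !poisson_leibniz.
rewrite [⁅pder a, c⁆]bracketC [⁅b, a⁆]bracketC [⁅b, c⁆]bracketC.
rewrite ![(- _) ⋅ _]pmulC !linearNr /= opprK opprD.
set A := b ⋅ ⁅c, _⁆; set B := b ⋅ ⁅a, _⁆; set C := pder c ⋅ _; set D := pder a ⋅ _.
by rewrite [B + C]addrC -!addrA [- D + _]addrCA addNr addr0 [- A + _]addrC addrCA
  [C + _]addrC addrNK addrC.
Qed.

HB.instance Definition _ := NovikovLie_isGD.Build k (gd_of P) dcirc_compat.

End GDOf.

Definition special (k : fieldType) (V : gdAlgType k) : Prop :=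
  exists (P : diffPoissonAlgType k) (f : {linear V -> gd_of P}),
    gd_morphism f /\ injective f.

(* Main.v *)
(** Give the derivation and the bracket weight 1, the product weight 0, and the elements
of V, embedded in P, weight -1. The key fact is that an element of weight -1 of the
differential Poisson algebra generated by V already lies in V, and that it lies in the
Gelfand-Dorfman ideal I whenever it belongs to the differential Poisson ideal generated
by I. Hence V / I embeds in the quotient of the generated algebra by that ideal, provided
that the weight is made into a genuine grading: homogeneous components of different weight
are added formally, in P[t, 1/t], rather than in P.

For the key fact, weight n >= -1 is replaced by the condition that multiplication by n + 1
elements of V leads into V; such multipliers are stable under all operations. *)

From HB Require Import structures.
Require Import Defs.
From mathcomp Require Import all_boot all_algebra.
From mathcomp Require Import zify boolp.

Set Implicit Arguments.
Unset Strict Implicit.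
Unset Printing Implicit Defensive.

Import GRing.Theory.
Local Open Scope ring_scope.
Local Open Scope gd_scope.

(** * Sign and Leibniz rules for brackets *)

Lemma lie_antisym (k : fieldType) (L : lieAlgType k) (x y : L) : ⁅x, y⁆ = - ⁅y, x⁆.
Proof.
have := bracketxx (x + y); rewrite linearDl /= !linearDr /= !bracketxx add0r addr0.
by move/eqP; rewrite addr_eq0 => /eqP.
Qed.

Lemma poisson_leibnizl (k : fieldType) (P : poissonAlgType k) (x y z : P) :
  ⁅x ⋅ y, z⁆ = x ⋅ ⁅y, z⁆ + y ⋅ ⁅x, z⁆.
Proof.
rewrite lie_antisym poisson_leibniz opprD.
by rewrite [⁅y, z⁆]lie_antisym [⁅x, z⁆]lie_antisym !linearNr.
Qed.

(* [filt false] plays the role of V and [filt true] that of the ideal I, so that closure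
   of V and absorption by I are one and the same statement, indexed by [||]. *)
Record gd_filtration (k : fieldType) (P : diffPoissonAlgType k) := GDFiltration {
  filt :> bool -> P -> Prop;
  filt0 : forall s, filt s 0;
  filtP : forall s a x y, filt s x -> filt s y -> filt s (a *: x + y);
  filt_circ : forall s s' x y, filt s x -> filt s' y -> filt (s || s') (x ⋅ pder y);
  filt_bracket : forall s s' x y, filt s x -> filt s' y -> filt (s || s') ⁅x, y⁆
}.

(** * Multipliers and the weights they generate *)

Section Multipliers.
Variables (k : fieldType) (P : diffPoissonAlgType k) (F : gd_filtration P).
Implicit Types (s : bool) (a b c : nat) (m n : int) (p q x y z : P).

(** The index [a] stands for weight [a - 1]: each factor from [F] lowers the weight by 1. One factor
    flagged [true] flags the whole product. *)
Fixpoint multiplier s a p : Prop :=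
  if a is a'.+1 then forall s' y, F s' y -> multiplier (s || s') a' (p ⋅ y)
  else F s p.

Lemma multiplier0 s a : multiplier s a 0.
Proof.
elim: a s => [|a IH] s /=; first exact: filt0.
by move=> s' y _; rewrite linear0l.
Qed.

Lemma multiplierP s a t p q :
  multiplier s a p -> multiplier s a q -> multiplier s a (t *: p + q).
Proof.
elim: a s p q => [|a IH] s p q /=; first exact: filtP.
by move=> Bp Bq s' y Fy; rewrite linearPl; apply: IH; [exact: Bp | exact: Bq].
Qed.

Lemma multiplierB s a p q :
  multiplier s a p -> multiplier s a q -> multiplier s a (p - q).
Proof. by move=> Bp Bq; rewrite addrC -scaleN1r; exact: multiplierP. Qed.

(** Weights add: [(a - 1) + (b - 1) = c - 1]. Factors from [F] are fed to [p] until it lies in [F];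
    then [p] itself serves as a factor for [q]. *)
Lemma multiplier_mul s s' a b c p q : multiplier s a p -> multiplier s' b q ->
  (a + b)%N = c.+1 -> multiplier (s || s') c (p ⋅ q).
Proof.
elim: a s p c => [|a IH] s p c /=.
  move=> Fp Bq; rewrite add0n => b_eq.
  by rewrite b_eq /= in Bq; rewrite pmulC orbC; exact: Bq.
(* For [c = 0] no factor from [F] is at hand, but then [q] lies in [F] and is the one factor that
   [p] awaits. *)
move=> Bp Bq []; case: c => [|c] ab.
  have [a0 b0] : a = 0 /\ b = 0 by lia.
  by rewrite a0 /= in Bp; rewrite b0 /= in Bq; exact: Bp.
move=> r y Fy /=; rewrite orbAC -pmulA [q ⋅ y]pmulC pmulA.
by apply: IH => //; exact: Bp.
Qed.

(** The Leibniz rule moves the derivation off [p]. In the correction term, [p ⋅ pder y ⋅ z] is [p]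
    times the single element [z ∘ y] of [F], so the next two factors cost [p] only one. *)
Lemma multiplier_der s a p : multiplier s a p -> multiplier s a.+1 (pder p).
Proof.
elim: a s p => [|a IH] s p Bp s' y Fy.
  by rewrite pmulC orbC; exact: filt_circ.
have -> : pder p ⋅ y = pder (p ⋅ y) - p ⋅ pder y by rewrite pder_mul addrC addKr.
apply: (@multiplierB _ a.+1); first by apply: IH; exact: Bp.
move=> r z Fz; rewrite -pmulA [pder y ⋅ z]pmulC -orbA [s' || r]orbC.
by apply: Bp; exact: filt_circ.
Qed.

Lemma multiplier_bracketl s s' a p y :
  multiplier s a p -> F s' y -> multiplier (s || s') a ⁅p, y⁆.
Proof.
move=> Bp Fy; elim: a s p Bp => [|a IH] s p Bp; first exact: filt_bracket.
move=> r z Fz.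
have -> : ⁅p, y⁆ ⋅ z = ⁅p ⋅ z, y⁆ - p ⋅ ⁅z, y⁆.
  by rewrite poisson_leibnizl addrAC subrr add0r pmulC.
apply: multiplierB; first by rewrite orbAC; apply: IH; exact: Bp.
by rewrite -orbA [s' || r]orbC; apply: Bp; exact: filt_bracket.
Qed.

(** Induction on [a]: by the Leibniz rule a factor [y] passes into the first argument, up to
    [p ⋅ ⁅y, q⁆], where [⁅y, q⁆] has index [b] and [multiplier_mul] applies. *)
Lemma multiplier_bracket s s' a b p q : multiplier s a p -> multiplier s' b q ->
  multiplier (s || s') (a + b) ⁅p, q⁆.
Proof.
move=> + Bq; elim: a s p => [|a IH] s p Bp.
  by rewrite lie_antisym -sub0r orbC; apply: multiplierB (multiplier0 _ _) _;
     exact: multiplier_bracketl.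
move=> r y Fy.
have -> : ⁅p, q⁆ ⋅ y = ⁅p ⋅ y, q⁆ - p ⋅ ⁅y, q⁆.
  by rewrite poisson_leibnizl addrAC subrr add0r pmulC.
apply: multiplierB; first by rewrite orbAC; apply: IH; exact: Bp.
rewrite -orbA; apply: (multiplier_mul Bp _ (addSn _ _)).
rewrite lie_antisym -sub0r; apply: multiplierB (multiplier0 _ _) _.
exact: multiplier_bracketl.
Qed.

(** Products of elements of [F] reach weights below -1, where there are no multipliers, hence
    integer weights. Derivation and bracket need no constructors, since multipliers are already
    stable under them. *)
Inductive weighted : bool -> int -> P -> Prop :=
| weighted0 s n : weighted s n 0
| weighted_base s a p : multiplier s a p -> weighted s (a%:Z - 1) p
| weightedP s n t p q : weighted s n p -> weighted s n q -> weighted s n (t *: p + q)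
| weighted_mul s s' n n' p q : weighted s n p -> weighted s' n' q ->
    weighted (s || s') (n + n') (p ⋅ q).

Lemma weightedD s n p q : weighted s n p -> weighted s n q -> weighted s n (p + q).
Proof. by move=> Wp Wq; rewrite -[p]scale1r; exact: weightedP. Qed.

Lemma weightedZ s n t p : weighted s n p -> weighted s n (t *: p).
Proof. by move=> Wp; rewrite -[_ *: _]addr0; exact: weightedP (weighted0 _ _). Qed.

Lemma weightedN s n p : weighted s n p -> weighted s n (- p).
Proof. by rewrite -scaleN1r; exact: weightedZ. Qed.

Lemma weighted_sum s n I (r : seq I) (h : I -> P) :
  (forall i, weighted s n (h i)) -> weighted s n (\sum_(i <- r) h i).
Proof.
by move=> Wh; elim/big_rec: _ => [|i x _]; [exact: weighted0 | exact: weightedD].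
Qed.

Lemma weighted_der s n p : weighted s n p -> weighted s (n + 1) (pder p).
Proof.
elim=> {s n p} [s n|s a p Bp|s n t p q _ IHp _ IHq|s s' n n' p q Wp IHp Wq IHq].
- by rewrite linear0; exact: weighted0.
- have -> : a%:Z - 1 + 1 = a.+1%:Z - 1 by lia.
  by apply: weighted_base; exact: multiplier_der.
- by rewrite linearP; exact: weightedP.
- rewrite pder_mul; apply: weightedD; first by rewrite -addrA; exact: weighted_mul.
  by rewrite addrAC; exact: weighted_mul.
Qed.

(** The Leibniz rule in each argument reduces this to the bracket of two multipliers. *)
Lemma weighted_bracket s s' n n' p q : weighted s n p -> weighted s' n' q ->
  weighted (s || s') (n + n' + 1) ⁅p, q⁆.
Proof.
move=> Wp Wq.
elim: Wp => {s n p} [s n|s a p Bp|s n t p p' _ IHp _ IHp'|s r n m p p' Wp IHp Wp' IHp'].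
- by rewrite linear0l; exact: weighted0.
- elim: Wq => {s' n' q} [s' n|s' b q Bq|s' n t q q' _ IHq _ IHq'|s' r n m q q' Wq IHq Wq' IHq'].
  + by rewrite linear0r; exact: weighted0.
  + have -> : a%:Z - 1 + (b%:Z - 1) + 1 = (a + b)%N%:Z - 1 by lia.
    by apply: weighted_base; exact: multiplier_bracket.
  + by rewrite linearPr; exact: weightedP.
  + rewrite poisson_leibniz; apply: weightedD.
      have -> : a%:Z - 1 + (n + m) + 1 = n + (a%:Z - 1 + m + 1) by lia.
      by rewrite orbCA; exact: weighted_mul.
    have -> : a%:Z - 1 + (n + m) + 1 = m + (a%:Z - 1 + n + 1) by lia.
    by rewrite [s' || r]orbC orbCA; exact: weighted_mul.
- by rewrite linearPl; exact: weightedP.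
- rewrite poisson_leibnizl; apply: weightedD.
    have -> : n + m + n' + 1 = n + (m + n' + 1) by lia.
    by rewrite -orbA; exact: weighted_mul.
  have -> : n + m + n' + 1 = m + (n + n' + 1) by lia.
  by rewrite [s || r]orbC -orbA; exact: weighted_mul.
Qed.

(* In negative weight there is no multiplier condition on [p] itself; the second
   clause replaces it and makes the conjunction stable under products. *)
Lemma weighted_multiplier s n p : weighted s n p ->
  (forall a, n = a%:Z - 1 -> multiplier s a p) /\
  (forall s' b c q, multiplier s' b q -> n + b%:Z = c%:Z ->
     multiplier (s || s') c (p ⋅ q)).
Proof.
elim=> {s n p} [s n|s a p Bp|s n t p q _ [IHp1 IHp2] _ [IHq1 IHq2]
  |s s' n n' p q _ [IHp1 IHp2] _ [IHq1 IHq2]]; split=> [a' E|r b c q' Bq' E].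
- exact: multiplier0.
- by rewrite linear0l; exact: multiplier0.
- by have -> : a' = a by lia.
- by apply: multiplier_mul Bp Bq' _; lia.
- by apply: multiplierP; [exact: IHp1 | exact: IHq1].
- by rewrite linearPl; apply: multiplierP; [exact: IHp2 E | exact: IHq2 E].
(* The weights add up to at least -1, so one of them is nonnegative. That factor is a multiplier by
   its first clause, and the second clause of the other factor applies to it. *)
- have [n_ge0|n_lt0] := boolP (0 <= n).
    rewrite pmulC orbC; apply: (IHq2 s (absz (n + 1)%R)); last by lia.
    by apply: IHp1; lia.
  apply: (IHp2 s' (absz (n' + 1)%R)); last by lia.
  by apply: IHq1; lia.
(* The sum of [n' + b] and [n + b] is [c + b], so they are not both negative; [q'] is first
   multiplied by a factor for which the result has a nonnegative index. *)
- have [nb_ge0|nb_lt0] := boolP (0 <= n' + b%:Z).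
    rewrite -pmulA -orbA; apply: (IHp2 _ (absz (n' + b%:Z)%R)); last by lia.
    by apply: IHq2 Bq' _; lia.
  rewrite [p ⋅ q]pmulC -pmulA [s || s']orbC -orbA.
  apply: (IHq2 _ (absz (n + b%:Z)%R)); last by lia.
  by apply: IHp2 Bq' _; lia.
Qed.

(** The key fact: weight -1 is index 0, where being a multiplier means lying in [F]. *)
Lemma weighted_filt s p : weighted s (- 1) p -> F s p.
Proof. by case/weighted_multiplier => /(_ 0%N) + _; apply. Qed.

End Multipliers.

(** * Formal sums of homogeneous elements, and congruence modulo the ideal *)

Section FormalSums.
Variables (k : fieldType) (P : diffPoissonAlgType k) (F : gd_filtration P).

Record homogeneous := Homogeneous {
  weight : int;
  value : P;
  valueP : weighted F false weight value
}.

Implicit Types (n : int) (l : seq homogeneous) (x y z : homogeneous).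

(* A list stands for the formal sum of its elements: a Laurent polynomial over [P] whose
   coefficients lie in the generated algebra. *)
Definition component n l : P := \sum_(x <- l) (if weight x == n then value x else 0).

Lemma component_nil n : component n [::] = 0.
Proof. by rewrite /component big_nil. Qed.

Lemma component_cat n l l' : component n (l ++ l') = component n l + component n l'.
Proof. by rewrite /component big_cat. Qed.

Definition scaleh (a : k) x :=
  @Homogeneous (weight x) (a *: value x) (weightedZ a (@valueP x)).

Lemma component_scale n a l : component n (map (scaleh a) l) = a *: component n l.
Proof.
rewrite /component big_map scaler_sumr; apply: eq_bigr => x _ /=.
by case: ifP => _; rewrite ?scaler0.
Qed.

Definition derh x :=
  @Homogeneous (weight x + 1) (pder (value x)) (weighted_der (@valueP x)).

Lemma component_der n l : component n (map derh l) = pder (component (n - 1) l).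
Proof.
rewrite /component big_map linear_sum; apply: eq_bigr => x _ /=.
have -> : (weight x + 1 == n) = (weight x == n - 1) by lia.
by case: ifP => _; rewrite ?linear0.
Qed.

(** Treats the product (shift 0) and the bracket (shift 1) together. *)
Record weighted_op := WeightedOp {
  op :> {bilinear P -> P -> P};
  shift : int;
  opP : forall s s' n n' p q, weighted F s n p -> weighted F s' n' q ->
    weighted F (s || s') (n + n' + shift) (op p q)
}.

Definition oph (o : weighted_op) x y :=
  @Homogeneous (weight x + weight y + shift o) (o (value x) (value y))
    (opP o (@valueP x) (@valueP y)).

Definition ops (o : weighted_op) l l' := [seq oph o x y | x <- l, y <- l'].

(** Here [l] enters only through its components, which is all that a congruence controls;
    [component_opr] does the same for [l']. *)
Lemma component_opl o n l l' :
  component n (ops o l l') =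
    \sum_(y <- l') o (component (n - shift o - weight y) l) (value y).
Proof.
rewrite /component big_allpairs_dep exchange_big; apply: eq_bigr => y _ /=.
rewrite linear_sumlz; apply: eq_bigr => x _.
have -> : (weight x + weight y + shift o == n) = (weight x == n - shift o - weight y).
  by lia.
by case: ifP => _; rewrite ?linear0l.
Qed.

Lemma component_opr o n l l' :
  component n (ops o l l') =
    \sum_(x <- l) o (value x) (component (n - shift o - weight x) l').
Proof.
rewrite /component big_allpairs_dep; apply: eq_bigr => x _ /=.
rewrite linear_sumr; apply: eq_bigr => y _.
have -> : (weight x + weight y + shift o == n) = (weight y == n - shift o - weight x).
  by lia.
by case: ifP => _; rewrite ?linear0r.
Qed.

(** Comparing weight by weight makes the ideal graded, so that [weighted_filt] can be applied to the
    component of weight -1. *)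
Definition congruent l l' :=
  forall n, weighted F true n (component n l - component n l').

Lemma congruent_refl l : congruent l l.
Proof. by move=> n; rewrite subrr; exact: weighted0. Qed.

Lemma congruent_sym l l' : congruent l l' -> congruent l' l.
Proof. by move=> E n; rewrite -opprB; exact: weightedN. Qed.

Lemma congruent_trans l' l l'' : congruent l l' -> congruent l' l'' -> congruent l l''.
Proof.
move=> E E' n; rewrite -(subrK (component n l') (component n l)) -addrA.
exact: weightedD.
Qed.

Lemma congruent_cat l1 l2 l1' l2' :
  congruent l1 l1' -> congruent l2 l2' -> congruent (l1 ++ l2) (l1' ++ l2').
Proof.
by move=> E E' n; rewrite !component_cat opprD addrACA; exact: weightedD.
Qed.

Lemma congruent_scale a l l' :
  congruent l l' -> congruent (map (scaleh a) l) (map (scaleh a) l').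
Proof. by move=> E n; rewrite !component_scale -scalerBr; exact: weightedZ. Qed.

Lemma congruent_der l l' : congruent l l' -> congruent (map derh l) (map derh l').
Proof.
by move=> E n; have := weighted_der (E (n - 1)); rewrite subrK linearB /= -!component_der.
Qed.

Lemma congruent_op o l1 l2 l1' l2' :
  congruent l1 l1' -> congruent l2 l2' -> congruent (ops o l1 l2) (ops o l1' l2').
Proof.
(* One argument is changed at a time; each resulting term has one factor flagged [true], and [||]
   keeps the flag. *)
move=> E E'; apply: (@congruent_trans (ops o l1' l2)) => n.
  rewrite !component_opl -sumrB; apply: weighted_sum => y; rewrite -linearBl.
  by have := opP o (E (n - shift o - weight y)) (@valueP y); rewrite !subrK.
rewrite !component_opr -sumrB; apply: weighted_sum => x; rewrite -linearBr.
have := opP o (@valueP x) (E' (n - shift o - weight x)).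
by have -> : weight x + (n - shift o - weight x) + shift o = n by lia.
Qed.

End FormalSums.

(** * The quotient as a differential Poisson algebra *)

Section Envelope.
Variables (k : fieldType) (P : diffPoissonAlgType k) (F : gd_filtration P).

(** The quotient construction needs a choice structure and a boolean relation; both are obtained
    classically. *)
Notation sums := {classic seq (homogeneous F)}.

Definition congruentb : rel sums := fun l l' => `[< congruent l l' >].

Lemma congruentb_equiv : equiv_class_of congruentb.
Proof.
split=> [l|l l'|l' l l'']; first by apply/asboolP; exact: congruent_refl.
  by apply/asboolP/asboolP; exact: congruent_sym.
by move=> /asboolP E /asboolP E'; apply/asboolP; exact: congruent_trans E E'.
Qed.

Canonical congruent_rel := EquivRelPack congruentb_equiv.

Definition envelope : Type := {eq_quot congruent_rel}%qT.
HB.instance Definition _ := Choice.on envelope.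

Implicit Types (u v w : envelope) (l : seq (homogeneous F)) (o : weighted_op F).

Definition cls l : envelope := \pi_({eq_quot congruent_rel})%qT l.
Definition rep u : seq (homogeneous F) := repr (u : {eq_quot congruent_rel}%qT).

Lemma repK u : cls (rep u) = u. Proof. exact: reprK. Qed.

Lemma clsP l l' : cls l = cls l' <-> congruent l l'.
Proof.
split; first by move/eqmodP/asboolP.
by move=> E; apply/eqmodP/asboolP.
Qed.

Lemma rep_cls l : congruent (rep (cls l)) l.
Proof. by apply/clsP; rewrite repK. Qed.

Lemma clsW (Q : envelope -> Prop) : (forall l, Q (cls l)) -> forall u, Q u.
Proof. by move=> Ql u; rewrite -[u]repK. Qed.

(** Reduces the laws of the envelope to identities between components in [P], valid before passing
    to the quotient. *)
Lemma cls_eq l l' : (forall n, component n l = component n l') -> cls l = cls l'.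
Proof. by move=> E; apply/clsP => n; rewrite E subrr; exact: weighted0. Qed.

(* Locked: otherwise the rewrite rules [env_*E] match through the definitions. *)
Definition env_add := locked (fun u v => cls (rep u ++ rep v)).
Definition env_scale := locked (fun a u => cls (map (scaleh a) (rep u))).
Definition env_der := locked (fun u => cls (map (@derh _ _ F) (rep u))).
Definition env_op := locked (fun o u v => cls (ops o (rep u) (rep v))).

Lemma env_addE l l' : env_add (cls l) (cls l') = cls (l ++ l').
Proof. by rewrite /env_add -lock; apply/clsP; apply: congruent_cat; exact: rep_cls. Qed.

Lemma env_scaleE a l : env_scale a (cls l) = cls (map (scaleh a) l).
Proof. by rewrite /env_scale -lock; apply/clsP; apply: congruent_scale; exact: rep_cls. Qed.

Lemma env_derE l : env_der (cls l) = cls (map (@derh _ _ F) l).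
Proof. by rewrite /env_der -lock; apply/clsP; apply: congruent_der; exact: rep_cls. Qed.

Lemma env_opE o l l' : env_op o (cls l) (cls l') = cls (ops o l l').
Proof. by rewrite /env_op -lock; apply/clsP; apply: congruent_op; exact: rep_cls. Qed.

Let compE := (component_cat, component_nil, component_scale, component_der).

Fact env_addA : associative env_add.
Proof.
elim/clsW=> a; elim/clsW=> b; elim/clsW=> c; rewrite !env_addE.
by apply: cls_eq => n; rewrite !compE addrA.
Qed.

Fact env_addC : commutative env_add.
Proof.
elim/clsW=> a; elim/clsW=> b; rewrite !env_addE.
by apply: cls_eq => n; rewrite !compE addrC.
Qed.

Fact env_add0 : left_id (cls [::]) env_add.
Proof. by elim/clsW=> a; rewrite !env_addE. Qed.

Fact env_addN : left_inverse (cls [::]) (env_scale (- 1)) env_add.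
Proof.
elim/clsW=> a; rewrite env_scaleE env_addE.
by apply: cls_eq => n; rewrite !compE scaleN1r addNr.
Qed.

HB.instance Definition _ :=
  GRing.isZmodule.Build envelope env_addA env_addC env_add0 env_addN.

Fact env_scaleA a b u : env_scale a (env_scale b u) = env_scale (a * b) u.
Proof.
elim/clsW: u => u; rewrite !env_scaleE.
by apply: cls_eq => n; rewrite !compE scalerA.
Qed.

Fact env_scale1 : left_id 1 env_scale.
Proof.
by elim/clsW=> u; rewrite !env_scaleE; apply: cls_eq => n; rewrite !compE scale1r.
Qed.

Fact env_scaleDr : right_distributive env_scale +%R.
Proof.
move=> a; elim/clsW=> u; elim/clsW=> v; rewrite /GRing.add /= !(env_addE, env_scaleE).
by apply: cls_eq => n; rewrite !compE scalerDr.
Qed.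

Fact env_scaleDl u : {morph env_scale^~ u : a b / a + b}.
Proof.
elim/clsW: u => u a b; rewrite [RHS]/GRing.add /= !(env_addE, env_scaleE).
by apply: cls_eq => n; rewrite !compE scalerDl.
Qed.

HB.instance Definition _ := GRing.Zmodule_isLmodule.Build k envelope
  env_scaleA env_scale1 env_scaleDr env_scaleDl.

Lemma clsD l l' : cls l + cls l' = cls (l ++ l').
Proof. exact: env_addE. Qed.

Lemma clsZ a l : a *: cls l = cls (map (scaleh a) l).
Proof. exact: env_scaleE. Qed.

Lemma cls0 : 0 = cls [::].
Proof. by []. Qed.

Fact env_op_bilinear o : bilinear_for *:%R *:%R (env_op o).
Proof.
split=> [|] w a; elim/clsW: w => w; elim/clsW=> u; elim/clsW=> v /=;
  rewrite !(clsD, clsZ, env_opE); apply: cls_eq => n; rewrite !compE.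
  rewrite !component_opr big_cat big_map /= scaler_sumr; congr (_ + _).
  by apply: eq_bigr => x _; rewrite linearZl_LR.
rewrite !component_opl big_cat big_map /= scaler_sumr; congr (_ + _).
by apply: eq_bigr => x _; rewrite linearZr_LR.
Qed.

Fact env_der_linear : linear env_der.
Proof.
move=> a; elim/clsW=> u; elim/clsW=> v; rewrite !(clsD, clsZ, env_derE).
by apply: cls_eq => n; rewrite !compE linearP.
Qed.

(** The transport along [addr0] turns weight [n + n'] into the expected [n + n' + 0]. *)
Definition mul_op := @WeightedOp _ _ F (@pmul _ P) 0
  (fun s s' n n' p q Wp Wq => eq_ind_r (weighted F _ ^~ _) (weighted_mul Wp Wq) (addr0 _)).

Definition bracket_op := @WeightedOp _ _ F (@bracket _ P) 1 (@weighted_bracket _ _ F).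

Notation part n x := (if weight x == n then value x else 0).

(** Expands into triples of homogeneous elements, so that trilinear laws can be checked term by
    term. *)
Lemma component_triplel o o' n a b c : component n (ops o (ops o' a b) c) =
  \sum_(x <- a) \sum_(y <- b) \sum_(z <- c) part n (oph o (oph o' x y) z).
Proof. by rewrite /component !big_allpairs_dep. Qed.

Lemma component_tripler o o' n a b c : component n (ops o a (ops o' b c)) =
  \sum_(x <- a) \sum_(y <- b) \sum_(z <- c) part n (oph o x (oph o' y z)).
Proof.
rewrite /component !big_allpairs_dep; apply: eq_bigr => x _.
by rewrite big_allpairs_dep.
Qed.

Lemma sum_rotate (I J K : Type) (a : seq I) (b : seq J) (c : seq K) (G : I -> J -> K -> P) :
  \sum_(z <- c) \sum_(x <- a) \sum_(y <- b) G x y z =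
  \sum_(x <- a) \sum_(y <- b) \sum_(z <- c) G x y z.
Proof. by rewrite exchange_big; apply: eq_bigr => x _; exact: exchange_big. Qed.

Fact env_mulA : associative (env_op mul_op).
Proof.
elim/clsW=> a; elim/clsW=> b; elim/clsW=> c; rewrite !env_opE.
apply: cls_eq => n; rewrite component_triplel component_tripler.
apply: eq_bigr => x _; apply: eq_bigr => y _; apply: eq_bigr => z _ /=.
by rewrite !addr0 addrA pmulA.
Qed.

Fact env_mulC : commutative (env_op mul_op).
Proof.
elim/clsW=> a; elim/clsW=> b; rewrite !env_opE; apply: cls_eq => n.
rewrite /component !big_allpairs_dep exchange_big /=.
apply: eq_bigr => x _; apply: eq_bigr => y _.
by rewrite /= [weight y + _]addrC pmulC.
Qed.

(** Antisymmetry would not suffice in characteristic 2: the diagonal terms vanish by [bracketxx],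
    and the others cancel in pairs. *)
Fact env_bracketxx u : env_op bracket_op u u = 0.
Proof.
elim/clsW: u => u; rewrite env_opE cls0; apply: cls_eq => n.
rewrite component_nil /component big_allpairs_dep.
elim: u => [|x u IH]; rewrite ?big_nil // !big_cons /= bracketxx if_same add0r.
under [X in _ + X]eq_bigr do rewrite big_cons.
rewrite big_split /= IH addr0 -big_split big1 //= => y _.
rewrite [weight y + _]addrC; case: ifP => _; rewrite ?addr0 //.
by rewrite [⁅value y, _⁆]lie_antisym subrr.
Qed.

Fact env_jacobi u v w : let br := env_op bracket_op in
  br u (br v w) + br v (br w u) + br w (br u v) = 0.
Proof.
elim/clsW: u => a; elim/clsW: v => b; elim/clsW: w => c /=.
rewrite !(env_opE, clsD) cls0; apply: cls_eq => n.
rewrite !component_cat component_nil !component_tripler.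
(* All three cyclic sums are brought to the order [a], [b], [c]; then the weights of corresponding
   terms agree. *)
rewrite [X in _ + X + _]sum_rotate [X in _ + X + _]sum_rotate [X in _ + _ + X]sum_rotate.
rewrite -!big_split big1 // => x _ /=; rewrite -!big_split big1 //= => y _.
rewrite -!big_split big1 //= => z _.
have -> : weight y + (weight z + weight x + 1) + 1 =
  weight x + (weight y + weight z + 1) + 1 by lia.
have -> : weight z + (weight x + weight y + 1) + 1 =
  weight x + (weight y + weight z + 1) + 1 by lia.
by case: ifP => _; rewrite ?addr0 // bracket_jacobi.
Qed.

Fact env_leibniz u v w : let mul := env_op mul_op in let br := env_op bracket_op in
  br u (mul v w) = mul v (br u w) + mul w (br u v).
Proof.
elim/clsW: u => a; elim/clsW: v => b; elim/clsW: w => c /=.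
rewrite !(env_opE, clsD); apply: cls_eq => n.
rewrite component_cat !component_tripler.
rewrite [X in _ = X + _]exchange_big [X in _ = _ + X]sum_rotate -big_split.
apply: eq_bigr => x _; rewrite -big_split; apply: eq_bigr => y _.
rewrite -big_split; apply: eq_bigr => z _ /=; rewrite !addr0.
have -> : weight y + (weight x + weight z + 1) =
  weight x + (weight y + weight z) + 1 by lia.
have -> : weight z + (weight x + weight y + 1) =
  weight x + (weight y + weight z) + 1 by lia.
by case: ifP => _; rewrite ?addr0 // poisson_leibniz.
Qed.

Fact env_der_mul u v : let mul := env_op mul_op in
  env_der (mul u v) = mul u (env_der v) + mul (env_der u) v.
Proof.
elim/clsW: u => a; elim/clsW: v => b /=.
rewrite !(env_opE, env_derE, clsD); apply: cls_eq => n.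
rewrite component_cat /component big_map !big_allpairs_dep big_map -big_split.
apply: eq_bigr => x _; rewrite big_map -big_split; apply: eq_bigr => y _ /=.
rewrite !addr0 addrA [weight x + 1 + _]addrAC; case: ifP => _; rewrite ?addr0 //.
exact: pder_mul.
Qed.

Fact env_der_bracket u v : let br := env_op bracket_op in
  env_der (br u v) = br (env_der u) v + br u (env_der v).
Proof.
elim/clsW: u => a; elim/clsW: v => b /=.
rewrite !(env_opE, env_derE, clsD); apply: cls_eq => n.
rewrite component_cat /component big_map !big_allpairs_dep big_map -big_split.
apply: eq_bigr => x _; rewrite big_map -big_split; apply: eq_bigr => y _ /=.
rewrite addrA [weight x + 1 + _]addrAC; case: ifP => _; rewrite ?addr0 //.
exact: pder_bracket.
Qed.

HB.instance Definition _ := Lmodule_isLie.Build k envelope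
  (env_op_bilinear bracket_op) env_bracketxx env_jacobi.
HB.instance Definition _ := Lie_isPoisson.Build k envelope
  (env_op_bilinear mul_op) env_mulA env_mulC env_leibniz.
HB.instance Definition _ := Poisson_isDifferential.Build k envelope
  env_der_linear env_der_mul env_der_bracket.

End Envelope.

(** * Embedding the homomorphic image into the envelope *)

Section Quotient.
Variables (k : fieldType) (V W : gdAlgType k) (f : {linear V -> W}).
Variables (P : diffPoissonAlgType k) (g : {linear V -> gd_of P}).
Hypotheses (f_gd : gd_morphism f) (g_gd : gd_morphism g).

Definition kernel_filt (s : bool) (p : P) : Prop := exists2 v, s ==> (f v == 0) & p = g v.

(** The kernel of [f] absorbs the operation; abstract operations let one proof serve both [∘] and
    the bracket. *)
Lemma kernel_filt_op (opV : {bilinear V -> V -> V}) (opW : {bilinear W -> W -> W})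
    (opP : P -> P -> P) s s' x y :
  {morph f : u v / opV u v >-> opW u v} -> {morph g : u v / opV u v >-> opP u v} ->
  kernel_filt s x -> kernel_filt s' y -> kernel_filt (s || s') (opP x y).
Proof.
move=> fM gM [u fu ->] [v fv ->]; exists (opV u v); last by rewrite gM.
rewrite fM; case: s fu => [/eqP->|_]; first by rewrite linear0l eqxx.
by case: s' fv => [/eqP->|//]; rewrite linear0r eqxx.
Qed.

Lemma kernel_filt0 s : kernel_filt s 0.
Proof. by exists 0; rewrite linear0 ?eqxx ?implybT. Qed.

Lemma kernel_filtP s a x y :
  kernel_filt s x -> kernel_filt s y -> kernel_filt s (a *: x + y).
Proof.
move=> [u fu ->] [v fv ->]; exists (a *: u + v); rewrite linearP //.
by case: s fu fv => //= /eqP-> /eqP->; rewrite scaler0 addr0.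
Qed.

Definition kernel_filtration := GDFiltration kernel_filt0 kernel_filtP
  (fun s s' x y => @kernel_filt_op (@circ k V) (@circ k W) _ s s' x y f_gd.1 g_gd.1)
  (fun s s' x y => @kernel_filt_op (@bracket k V) (@bracket k W) _ s s' x y f_gd.2 g_gd.2).

Lemma weighted_embedding v : weighted kernel_filtration false (- 1) (g v).
Proof. by rewrite -[- 1]sub0r; apply: (@weighted_base _ _ _ _ 0%N); exists v. Qed.

Definition gen (v : V) : envelope kernel_filtration :=
  cls [:: Homogeneous (weighted_embedding v)].

Lemma gen_linear : linear gen.
Proof.
move=> a u v; rewrite clsZ clsD; apply: cls_eq => n.
rewrite /component !big_cons !big_nil /=.
by case: ifP; rewrite ?addr0 // linearP.
Qed.

(** Both sides have the same weight, [-1 + (-1 + 1) + 0 = -1]; for the bracket it is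
    [-1 + -1 + 1 = -1]. *)
Lemma gen_circ u v : gen (u ∘ v) = gen u ⋅ pder (gen v).
Proof.
rewrite /pder /pmul /= /gen env_derE env_opE; apply: cls_eq => n.
by rewrite /component !big_cons !big_nil /= g_gd.1.
Qed.

Lemma gen_bracket u v : gen ⁅u, v⁆ = ⁅gen u, gen v⁆.
Proof.
rewrite /bracket /= /gen env_opE; apply: cls_eq => n.
by rewrite /component !big_cons !big_nil /= g_gd.2.
Qed.

(** If the classes agree, the key fact puts [g u - g v] into the image of the kernel of [f], and
    injectivity of [g] gives [f (u - v) = 0]. Conversely [u - v] is the required kernel element. *)
Lemma gen_eq u v : injective g -> gen u = gen v <-> f u = f v.
Proof.
move=> g_inj; rewrite /gen clsP; split=> [/(_ (- 1))|fuv n].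
  rewrite /component !big_cons !big_nil /= !addr0 -linearB => /weighted_filt[w /=].
  by move=> /eqP fw /g_inj uvw; apply/eqP; rewrite -subr_eq0 -linearB uvw fw.
rewrite /component !big_cons !big_nil /= !addr0.
have [<-|_] := eqVneq (- 1) n; last by rewrite subrr; exact: weighted0.
rewrite -[- 1]sub0r; apply: (@weighted_base _ _ _ _ 0%N); exists (u - v) => /=.
  by rewrite linearB fuv subrr.
by rewrite linearB.
Qed.

End Quotient.

Theorem theorem1 (k : fieldType) (V W : gdAlgType k) (f : {linear V -> W}) :
  special V ->
  gd_morphism f ->
  (forall w : W, exists v : V, f v = w) ->
  special W.
Proof.
move=> [P [g [g_gd g_inj]]] f_gd /choice[lift liftK].
(* The section [lift] need not be linear. By [gen_eq] the class depends only on the image under [f],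
   so [h] inherits linearity and both operations from [gen]. *)
pose h w : gd_of (envelope (kernel_filtration f_gd g_gd)) := gen f_gd g_gd (lift w).
have hE v w : f v = w -> gen f_gd g_gd v = h w.
  by move=> fv; apply/(gen_eq f_gd g_gd _ _ g_inj); rewrite liftK.
have h_linear : linear h.
  move=> a u v; rewrite -[RHS]gen_linear; apply/esym/hE.
  by rewrite linearP !liftK.
pose hL : {linear W -> gd_of _} := HB.pack h (GRing.isLinear.Build k W _ *:%R h h_linear).
exists (envelope (kernel_filtration f_gd g_gd)), hL.
split; last first.
  by move=> u v /(gen_eq f_gd g_gd _ _ g_inj); rewrite !liftK.
split=> u v /=.
  by rewrite -[RHS]gen_circ; apply/esym/hE; rewrite f_gd.1 !liftK.
by rewrite -[RHS]gen_bracket; apply/esym/hE; rewrite f_gd.2 !liftK.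
Qed.
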